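(* The numbers of negative pentagons (5-cycles) and negative hexagons (6-cycles) in the six signed Petersen graphs are: $+P$: 0 negative pentagons, 0 negative hexagons; $P_1$: 4 and 4; $P_{2,2}$: 6 and 6; $P_{2,3}$ (which is switching isomorphic to $-P_1$): 8 and 4; $P_{3,2}$: 6 and 10; $P_{3,3}$ (which is switching isomorphic to $-P$): 12 and 0.
   Context: The Petersen graph $P$ has vertices $v_{ij}$ indexed by the 2-element subsets $\{i,j\}$ of $\{1,\dots,5\}$, with $v_{ij}v_{kl}$ an edge iff $\{i,j\}\cap\{k,l\}=\emptyset$. A signature is $\sigma:E(P)\to\{+,-\}$; the sign of a cycle is the product of the signs of its edges, and a cycle is negative if its sign is $-$. Switching by $\zeta:V\to\{+,-\}$ gives $\sigma^\zeta(vw)=\zeta(v)\sigma(vw)\zeta(w)$; switching isomorphism means isomorphism (sign-preserving graph isomorphism) to a switching. The distance between two edges is their distance in the line graph; in $P$ two disjoint edges have distance 2 if some edge joins an endpoint of one to an endpoint of the other, and distance 3 otherwise. $+P$: all edges positive; $-P$: all negative; $P_1$: exactly one negative edge; $P_{2,2}$ / $P_{2,3}$: exactly two negative edges at distance 2 / 3; $P_{3,2}$: exactly three negative edges forming alternate edges of a hexagon; $P_{3,3}$: exactly three negative edges pairwise at distance 3. *)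

(* Defs.v *)
From mathcomp Require Import all_boot.

Set Implicit Arguments.
Unset Strict Implicit.
Unset Printing Implicit Defensive.

Record sgraph := SGraph {
  vertex :> finType;
  adj : rel vertex;
  adj_sym : symmetric adj;
  adj_irrefl : irreflexive adj
}.

Section Graph.
Variable G : sgraph.

Definition is_edge (A : {set G}) : bool :=
  [exists v : G, exists w : G, adj v w && (A == [set v; w])].

Definition edge : Type := {A : {set G} | is_edge A}.

(* Cycles are unoriented and unbased: a k-cycle is the set of edges
   t_i t_(i+1) of some cyclic sequence t of k distinct vertices. *)
Definition is_kcycle (k : nat) (C : {set edge}) : bool :=
  (2 < k) &&
  [exists t : k.-tuple G,
    ucycleb (@adj G) t &&
    ([set val e | e in C] == [set [set v; next t v] | v in t])].

Definition at_distance (x y : G) (d : nat) : Prop :=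
  (exists p : seq G, [/\ path (@adj G) x p, last x p = y & size p = d]) /\
  (forall p : seq G, path (@adj G) x p -> last x p = y -> d <= size p).

Definition line_adj (e f : edge) : bool :=
  (e != f) && (val e :&: val f != set0).

Lemma line_adj_sym : symmetric line_adj.
Proof. by move=> e f; rewrite /line_adj eq_sym setIC. Qed.

Lemma line_adj_irrefl : irreflexive line_adj.
Proof. by move=> e; rewrite /line_adj eqxx. Qed.

End Graph.

Definition line_graph (G : sgraph) : sgraph :=
  SGraph (@line_adj_sym G) (@line_adj_irrefl G).

Definition edge_distance (G : sgraph) (e f : edge G) (d : nat) : Prop :=
  @at_distance (line_graph G) e f d.

(* The boolean b stands for the sign (-1)^b, so products of signs are
   exclusive ors. *)
Definition sign : Type := bool.
Definition pos : sign := false.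
Definition neg : sign := true.
Definition smul : sign -> sign -> sign := addb.

Definition signature (G : sgraph) : Type := edge G -> sign.

Section Signature.
Variable G : sgraph.
Implicit Type s : signature G.

Definition all_pos : signature G := fun=> pos.
Definition all_neg : signature G := fun=> neg.
Definition opp s : signature G := fun e => smul neg (s e).

Definition negative_edges s : {set edge G} := [set e | s e == neg].

Definition cycle_sign s (C : {set edge G}) : sign := \big[smul/pos]_(e in C) s e.

Definition num_negative_cycles s (k : nat) : nat :=
  #|[set C : {set edge G} | is_kcycle k C & cycle_sign s C == neg]|.

Definition switch (z : G -> sign) s : signature G :=
  fun e => smul (\big[smul/pos]_(v in val e) z v) (s e).

End Signature.

Arguments all_pos G : clear implicits.
Arguments all_neg G : clear implicits.

Definition signed_iso (G H : sgraph) (s : signature G) (t : signature H)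
    (f : G -> H) : Prop :=
  [/\ bijective f,
      forall v w : G, adj (f v) (f w) = adj v w
    & forall (e : edge G) (e' : edge H), val e' = f @: val e -> t e' = s e].

Definition switching_isomorphic (G H : sgraph) (s : signature G)
    (t : signature H) : Prop :=
  exists (z : H -> sign) (f : G -> H), signed_iso s (switch z t) f.

Definition petersen_vertex : Type := {A : {set 'I_5} | #|A| == 2}.

Definition petersen_adj (x y : petersen_vertex) : bool :=
  [disjoint val x & val y].

Lemma petersen_adj_sym : symmetric petersen_adj.
Proof. by move=> x y; rewrite /petersen_adj disjoint_sym. Qed.

Lemma petersen_adj_irrefl : irreflexive petersen_adj.
Proof.
move=> x; rewrite /petersen_adj -setI_eq0 setIid -cards_eq0.
by rewrite (eqP (valP x)).
Qed.

Definition petersen : sgraph := SGraph petersen_adj_sym petersen_adj_irrefl.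

Definition is_P1 (s : signature petersen) : Prop :=
  #|negative_edges s| = 1.

Definition is_P22 (s : signature petersen) : Prop :=
  exists e f : edge petersen,
    negative_edges s = [set e; f] /\ edge_distance e f 2.

Definition is_P23 (s : signature petersen) : Prop :=
  exists e f : edge petersen,
    negative_edges s = [set e; f] /\ edge_distance e f 3.

Definition is_P32 (s : signature petersen) : Prop :=
  exists v0 v1 v2 v3 v4 v5 : petersen,
    ucycle (@adj petersen) [:: v0; v1; v2; v3; v4; v5] /\
    [set val e | e in negative_edges s] =
      [set [set v0; v1]; [set v2; v3]; [set v4; v5]].

Definition is_P33 (s : signature petersen) : Prop :=
  #|negative_edges s| = 3 /\
  {in negative_edges s &, forall e f, e != f -> edge_distance e f 3}.

(* Main.v *)
(* Sets over a finite type do not compute, so a subset is coded by the sublist of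
   a fixed list of labels formed by the labels of its members. This is applied
   three times: to the 2-subsets of {0, ..., 4}, to the edges of the Petersen
   graph as sets of vertices, and to its cycles as sets of edges. The sign of a
   cycle is the parity of the number of its negative edges, so all counts become
   evaluations over the codes of the 12 pentagons and 10 hexagons. The switching
   isomorphisms rest on one cut: three edges pairwise at distance 3 are exactly
   the edges not crossing the cut around their six ends. *)

Require Import Defs.
From mathcomp Require Import all_boot fingroup perm.

Set Implicit Arguments.
Unset Strict Implicit.
Unset Printing Implicit Defensive.

(** * Negative edges and three-element sets *)

Lemma mem_negative_edges (G : sgraph) (s : signature G) e :
  (e \in negative_edges s) = s e.
Proof. by rewrite inE; apply: eqb_id. Qed.

Lemma card3_set (X : finType) (A : {set X}) : #|A| = 3 ->
  exists x y z, [/\ x != y, x != z, y != z & A =i [:: x; y; z]].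
Proof.
rewrite cardE; have := mem_enum A; have := enum_uniq A.
case: (enum A) => [|x [|y [|z [|? ?]]]] //= A_uniq A_enum _; exists x, y, z.
move: A_uniq; rewrite !inE negb_or andbT => /andP[/andP[xy xz] yz].
by split=> // u; rewrite -A_enum.
Qed.

(** * Coding subsets of a finite type by sublists *)

Section SubsetCode.
Variables (X : finType) (T : eqType) (code : X -> T) (V : seq T).

(** Filtering the fixed list [V] puts the labels in a canonical order, so that equality of sets
    becomes computable equality of sequences. *)
Definition set_code (A : {set X}) : seq T := [seq v <- V | v \in image code A].

Hypotheses (code_inj : injective code) (code_mem : forall x, code x \in V).

Lemma mem_set_code A x : (code x \in set_code A) = (x \in A).
Proof. by rewrite mem_filter code_mem andbT mem_image. Qed.

Lemma set_code_inj : injective set_code.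
Proof. by move=> A B eqAB; apply/setP=> x; rewrite -!mem_set_code eqAB. Qed.

Lemma has_set_code A B :
  has (mem (set_code A)) (set_code B) = (A :&: B != set0).
Proof.
apply/hasP/set0Pn=> [[c] | [x /setIP[Ax Bx]]]; last first.
  by exists (code x); rewrite /= mem_set_code.
rewrite mem_filter => /andP[/imageP[x Bx ->] _]; rewrite /= mem_set_code => Ax.
by exists x; rewrite inE Ax.
Qed.

Hypothesis V_uniq : uniq V.

Lemma perm_set_code A : perm_eq (set_code A) (image code A).
Proof.
apply: uniq_perm; first exact: filter_uniq.
  by rewrite map_inj_uniq ?enum_uniq.
move=> c; rewrite mem_filter; apply: andb_idr.
by case/imageP=> x _ ->.
Qed.

(** The sum modulo 2 of an indicator is the parity of a count on the code. This evaluates both the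
    sign of a cycle and the switching factor of an edge, which is a sum over its two ends. *)
Lemma bigaddb_set_code (N : seq T) (A : {set X}) :
  \big[addb/false]_(x in A) (code x \in N) =
    odd (count (mem N) (set_code A)).
Proof.
rewrite (seq.permP (perm_set_code A)) count_map -big_enum /=.
by elim: (enum A) => [|x s IHs]; rewrite ?big_nil // big_cons IHs /= oddD oddb.
Qed.

End SubsetCode.

(** * Edges, cycles and edge distances of a coded graph *)

Section GraphCode.
Variables (T : eqType) (V : seq T) (a : rel T).

Definition pair_code (x y : T) : seq T := [seq v <- V | v \in [:: x; y]].

(** An edge arises from both orders of its ends with the same [pair_code], hence [undup]. *)
Definition edge_codes : seq (seq T) :=
  undup (flatten [seq [seq pair_code x y | y <- V & a x y] | x <- V]).

(** Adjacency is tested as each vertex is prepended, which keeps the enumeration small enough to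
    compute; repeated vertices and open ends are removed only in [cycle_walks]. *)
Fixpoint walks (k : nat) : seq (seq T) :=
  if k is k'.+1 then
    flatten [seq [seq x :: t | t <- walks k' & path a x t] | x <- V]
  else [:: [::]].

Definition cycle_walks (k : nat) : seq (seq T) :=
  [seq t <- walks k | ucycleb a t].

Definition walk_code (t : seq T) : seq (seq T) :=
  [seq c <- edge_codes | c \in [seq pair_code x (next t x) | x <- t]].

(** A k-cycle is traversed by 2k closed walks, one for each starting point and direction, all with
    the same [walk_code]; [undup] keeps one. *)
Definition cycle_codes (k : nat) : seq (seq (seq T)) :=
  undup [seq walk_code t | t <- cycle_walks k].

Definition meet_codes (c d : seq T) : bool := (c != d) && has (mem c) d.

Definition linked_codes (c d : seq T) : bool :=
  has (fun x => meet_codes c x && meet_codes x d) edge_codes.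

Definition dist2_codes (c d : seq T) : bool :=
  [&& c != d, ~~ meet_codes c d & linked_codes c d].

(** This excludes the distances 0, 1 and 2 and sets no upper bound; only the implication from
    distance 3 to this test is used. *)
Definition dist3_codes (c d : seq T) : bool :=
  [&& c != d, ~~ meet_codes c d & ~~ linked_codes c d].

Definition alternate_codes (t : seq T) : seq (seq T) :=
  if t is [:: v0; v1; v2; v3; v4; v5] then
    [:: pair_code v0 v1; pair_code v2 v3; pair_code v4 v5]
  else [::].

Lemma mem_walks k t :
  (t \in walks k) = [&& size t == k, all (mem V) t & sorted a t].
Proof.
elim: k t => [|k IHk] [|x t] //=.
  by apply/negP=> /flatten_mapP[x _ /mapP[]].
apply/flatten_mapP/idP=> [[y Vy /mapP[u]] | /and3P[size_t /andP[Vx Vt] a_t]].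
  rewrite mem_filter IHk => /andP[a_u /and3P[size_u Vu _]] [-> ->].
  by rewrite eqSS size_u Vy Vu.
exists x => //; apply/mapP; exists t => //.
by rewrite mem_filter a_t IHk -eqSS size_t Vt (path_sorted a_t).
Qed.

Lemma mem_cycle_walks k t :
  (t \in cycle_walks k) = [&& size t == k, all (mem V) t & ucycleb a t].
Proof.
rewrite mem_filter mem_walks andbC -!andbA; do 2!congr (_ && _).
(* A nonempty closed walk already satisfies [path a x t], so the [sorted] test is absorbed. *)
case: t => [|x t]; rewrite /ucycleb /= ?rcons_path //.
by case: (path a x t); rewrite ?andbF.
Qed.

Variables (G : sgraph) (code : G -> T).
Hypotheses (code_inj : injective code) (memV : V =i codom code).
Hypothesis code_adj : forall x y, a (code x) (code y) = adj x y.

Let code_mem x : code x \in V.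
Proof. by rewrite memV codom_f. Qed.

Definition edge_code (e : edge G) : seq T := set_code code V (val e).

Lemma set_code2 x y : set_code code V [set x; y] = pair_code (code x) (code y).
Proof.
apply: eq_filter => v; rewrite !inE.
apply/imageP/orP=> [[z] | [/eqP->|/eqP->]].
- by rewrite !inE => /orP[]/eqP-> ->; [left | right].
- by exists x; rewrite ?set21.
- by exists y; rewrite ?set22.
Qed.

Lemma edge_code_inj : injective edge_code.
Proof. by move=> e f /(set_code_inj code_inj code_mem)/val_inj. Qed.

Lemma mem_edge_codes : edge_codes =i codom edge_code.
Proof.
move=> c; rewrite mem_undup; apply/flatten_mapP/codomP.
  case=> p Vp /mapP[q]; rewrite mem_filter => /andP[apq Vq ->].
  move: Vp Vq apq; rewrite !memV => /codomP[x ->] /codomP[y ->].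
  rewrite code_adj => adj_xy.
  have xy_edge : is_edge [set x; y].
    by apply/existsP; exists x; apply/existsP; exists y; rewrite adj_xy eqxx.
  by exists (Sub [set x; y] xy_edge); rewrite -set_code2 /edge_code SubK.
case=> e ->; case/existsP: (valP e) => x /existsP[y /andP[adj_xy /eqP val_e]].
exists (code x) => //; apply/mapP; exists (code y).
  by rewrite mem_filter code_adj adj_xy code_mem.
by rewrite /edge_code val_e set_code2.
Qed.

Lemma edge_code_mem e : edge_code e \in edge_codes.
Proof. by rewrite mem_edge_codes codom_f. Qed.

Lemma edge_code2 (e : edge G) x y :
  (edge_code e == pair_code (code x) (code y)) = (val e == [set x; y]).
Proof. by rewrite -set_code2 (inj_eq (set_code_inj code_inj code_mem)). Qed.

Lemma mem_alternate_codes (e : edge G) v0 v1 v2 v3 v4 v5 :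
  (edge_code e
     \in alternate_codes [seq code v | v <- [:: v0; v1; v2; v3; v4; v5]]) =
    (val e \in [set [set v0; v1]; [set v2; v3]; [set v4; v5]]).
Proof. by rewrite !inE !edge_code2 orbA. Qed.

Lemma ucycle_code t : ucycleb a [seq code x | x <- t] = ucycleb (@adj G) t.
Proof.
rewrite /ucycleb (map_inj_uniq code_inj) cycle_map.
by congr (_ && _); case: t => //= x t; apply: eq_path => y z; apply: code_adj.
Qed.

Lemma cycle_code (C : {set edge G}) t : uniq t ->
    [set val e | e in C] = [set [set v; next t v] | v in t] ->
  set_code edge_code edge_codes C = walk_code [seq code x | x <- t].
Proof.
move=> t_uniq valC; apply: eq_in_filter => c; rewrite mem_edge_codes.
case/codomP=> e ->; rewrite (mem_image edge_code_inj).
(* Injectivity of [val] turns membership of an edge in [C] into membership of its vertex pair in the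
   image, where [valC] applies. *)
rewrite -(mem_imset _ _ val_inj) valC.
apply/imsetP/mapP=> [[v tv val_e] | [_ /mapP[v tv ->] /eqP]].
  exists (code v); first exact: map_f.
  by apply/eqP; rewrite next_map // edge_code2 val_e.
by rewrite next_map // edge_code2 => /eqP; exists v.
Qed.

Lemma cycle_codesP k c : 2 < k ->
  reflect (exists2 C, is_kcycle k C & c = set_code edge_code edge_codes C)
          (c \in cycle_codes k).
Proof.
move=> k_gt2; rewrite mem_undup; apply: (iffP mapP) => [[t] | [C]].
  rewrite mem_cycle_walks => /and3P[size_t Vt t_cycle] ->{c}.
  have [u def_t] : exists u, t = [seq code x | x <- u].
    elim: t Vt {size_t t_cycle} => [|p t IHt] /=; first by exists nil.
    case/andP; rewrite memV => /codomP[x ->] /IHt[u ->].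
    by exists (x :: u).
  rewrite {t Vt}def_t size_map ucycle_code in size_t t_cycle *.
  have [cyc_u uniq_u] := andP t_cycle.
  (* Consecutive vertices of [u] are adjacent, so every such pair is an edge and this preimage under
     [val] misses none of them. *)
  pose C := [set e : edge G | val e \in [set [set v; next u v] | v in u]].
  have valC : [set val e | e in C] = [set [set v; next u v] | v in u].
    apply/setP=> A; apply/imsetP/idP=> [[e] | uA].
      by rewrite inE => ? ->.
    have A_edge : is_edge A.
      case/imsetP: uA => v uv ->; apply/existsP; exists v; apply/existsP.
      by exists (next u v); rewrite (next_cycle cyc_u uv) eqxx.
    by exists (Sub A A_edge); rewrite ?inE SubK.
  exists C; last by rewrite (cycle_code uniq_u valC).
  rewrite /is_kcycle k_gt2; apply/existsP; exists (Tuple size_t).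
  by rewrite t_cycle valC eqxx.
case/andP=> _ /existsP[t /andP[t_cycle /eqP valC]] ->.
have [_ t_uniq] := andP t_cycle.
exists [seq code x | x <- t]; last exact: cycle_code.
rewrite mem_cycle_walks size_map size_tuple eqxx ucycle_code t_cycle andbT /=.
by apply/allP=> _ /mapP[x _ ->]; apply: code_mem.
Qed.

(** Coding is injective and maps the k-cycles onto [cycle_codes k], so the codes of the negative
    cycles and the codes with an odd number of labels in [N] form two duplicate-free lists with the
    same members. *)
Lemma num_negative_cycles_code (s : signature G) k (N : seq (seq T)) : 2 < k ->
    (forall e, s e = (edge_code e \in N)) ->
  num_negative_cycles s k =
    count (fun c => odd (count (mem N) c)) (cycle_codes k).
Proof.
move=> k_gt2 sE; rewrite -size_filter /num_negative_cycles cardE.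
pose scode := set_code edge_code edge_codes.
have scode_inj : injective scode := set_code_inj edge_code_inj edge_code_mem.
have signE C : cycle_sign s C = odd (count (mem N) (scode C)).
  rewrite -bigaddb_set_code ?undup_uniq //;
    [|exact: edge_code_inj|exact: edge_code_mem].
  by apply: eq_bigr => e _; rewrite sE.
rewrite -(size_map scode); apply/perm_size/uniq_perm.
- by rewrite (map_inj_uniq scode_inj) enum_uniq.
- exact/filter_uniq/undup_uniq.
move=> c; rewrite mem_filter; apply/mapP/andP=> [[C] | [c_neg]].
  rewrite mem_enum inE => /andP[C_cycle /eqP C_neg] ->; rewrite -signE C_neg.
  by split=> //; apply/cycle_codesP => //; exists C.
case/(cycle_codesP _ k_gt2) => C C_cycle def_c; exists C => //.
by rewrite mem_enum inE C_cycle signE /scode -def_c c_neg.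
Qed.

Lemma line_adj_code (e f : edge G) :
  line_adj e f = meet_codes (edge_code e) (edge_code f).
Proof.
by rewrite /line_adj /meet_codes has_set_code // inj_eq //; apply: edge_code_inj.
Qed.

Lemma edge_distance_gt1 (e f : edge G) d : 1 < d -> edge_distance e f d ->
  (edge_code e != edge_code f) && ~~ meet_codes (edge_code e) (edge_code f).
Proof.
move=> d_gt1 [_ dist_ge]; apply/andP; split.
  rewrite (inj_eq edge_code_inj); apply/eqP=> eq_ef.
  (* The empty walk here, and the walk [[:: f]] below, would force distance at most 0 and at most
     1. *)
  by have := leq_trans d_gt1 (dist_ge [::] isT eq_ef).
rewrite -line_adj_code; apply/negP=> adj_ef.
by have := leq_trans d_gt1 (dist_ge [:: f] _ erefl); rewrite /= adj_ef => /(_ isT).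
Qed.

Lemma edge_distance2_code (e f : edge G) :
  edge_distance e f 2 -> dist2_codes (edge_code e) (edge_code f).
Proof.
move=> dist_ef; rewrite /dist2_codes andbA (edge_distance_gt1 _ dist_ef) //=.
(* Only a walk with exactly two entries [g] and [h] has the right size, and [h] is [f]; so [g] links
   the two edges. *)
case: dist_ef => -[[|g [|h [|h1 p]]] [path_ef last_ef size_p]] _ //.
case/and3P: path_ef last_ef => adj_eg adj_gh _ def_h.
apply/hasP; exists (edge_code g); first exact: edge_code_mem.
by rewrite -!line_adj_code -def_h; apply/andP.
Qed.

Lemma edge_distance3_code (e f : edge G) :
  edge_distance e f 3 -> dist3_codes (edge_code e) (edge_code f).
Proof.
move=> dist_ef; rewrite /dist3_codes andbA (edge_distance_gt1 _ dist_ef) //=.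
case: dist_ef => _ dist_ge; apply/hasP=> -[c].
rewrite mem_edge_codes => /codomP[g ->].
rewrite -!line_adj_code => /andP[eg gf].
by have := dist_ge [:: g; f]; rewrite /= eg gf => /(_ isT erefl).
Qed.

End GraphCode.

(** The permutation found for the tails is corrected by the transposition of [p x] and [y]; neither
    point lies in the tail [t], so the images already fixed do not move. *)
Lemma perm_of_uniq_seqs (X : finType) (s t : seq X) :
  uniq s -> uniq t -> size s = size t ->
  exists p : {perm X}, [seq p x | x <- s] = t.
Proof.
elim: s t => [|x s IHs] [|y t] //=; first by exists 1%g.
case/andP=> s'x s_uniq /andP[t'y t_uniq] [size_s].
have [p def_t] := IHs t s_uniq t_uniq size_s.
exists (p * tperm (p x) y)%g; rewrite permM tpermL -[in RHS]def_t.
congr (_ :: _).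
apply/eq_in_map=> z sz; rewrite permM tpermD //.
  by rewrite (inj_eq perm_inj); apply: contraNneq s'x => ->.
by apply: contraNneq t'y => ->; rewrite -def_t map_f.
Qed.

(** * Codes of the vertices and edges of the Petersen graph *)

Definition vertex_code (x : petersen) : seq nat :=
  set_code val (iota 0 5) (val x).

Definition petersen_codes : seq (seq nat) :=
  [seq [:: i; j] | j <- iota 0 5, i <- iota 0 j].

Definition adj_codes (c d : seq nat) : bool := ~~ has (mem c) d.

Lemma ord_mem_iota n (i : 'I_n) : val i \in iota 0 n.
Proof. by rewrite mem_iota /=. Qed.

Lemma vertex_code_inj : injective vertex_code.
Proof.
by move=> x y /(set_code_inj val_inj (@ord_mem_iota 5)) /val_inj.
Qed.

Lemma vertex_code_adj (x y : petersen) :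
  adj_codes (vertex_code x) (vertex_code y) = adj x y.
Proof.
rewrite /adj_codes (has_set_code val_inj (@ord_mem_iota 5)) negbK.
exact: setI_eq0.
Qed.

Lemma vertex_code_mem x : vertex_code x \in petersen_codes.
Proof.
have: size (vertex_code x) == 2.
  have V_uniq : uniq (iota 0 5) by [].
  rewrite (perm_size (perm_set_code val_inj (@ord_mem_iota 5) V_uniq _)).
  by rewrite size_map -cardE (valP x).
(* There are 32 sublists of [iota 0 5]; those of length 2 are all listed, and the others contradict
   the size. *)
by rewrite /vertex_code /set_code /=; do 5!case: (_ \in _).
Qed.

(** Pigeonhole: the ten distinct vertex codes lie in a list of length ten, so they exhaust it. *)
Lemma petersen_codes_codom : petersen_codes =i codom vertex_code.
Proof.
have codom_sub : {subset codom vertex_code <= petersen_codes}.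
  by move=> _ /codomP[x ->]; apply: vertex_code_mem.
have codom_uniq : uniq (codom vertex_code).
  by rewrite map_inj_uniq ?enum_uniq //; apply: vertex_code_inj.
have card_petersen : #|petersen| = 10.
  by rewrite card_sig -[LHS]cardsE card_draws card_ord.
have size_le : size petersen_codes <= size (codom vertex_code).
  by rewrite size_codom card_petersen.
by have [_ eq_codom] := uniq_min_size codom_uniq codom_sub size_le; move=> c.
Qed.

Definition petersen_edge_codes : seq (seq (seq nat)) :=
  edge_codes petersen_codes adj_codes.

Definition pentagon_codes : seq (seq (seq (seq nat))) :=
  cycle_codes petersen_codes adj_codes 5.

Definition hexagon_codes : seq (seq (seq (seq nat))) :=
  cycle_codes petersen_codes adj_codes 6.

Definition far_codes : rel (seq (seq nat)) :=
  dist3_codes petersen_codes adj_codes.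

Definition petersen_edge_code : edge petersen -> seq (seq nat) :=
  edge_code petersen_codes vertex_code.

Definition has_counts (N : seq (seq (seq nat))) (m n : nat) : bool :=
  (count (fun c => odd (count (mem N) c)) pentagon_codes == m) &&
  (count (fun c => odd (count (mem N) c)) hexagon_codes == n).

Lemma petersen_edge_code_inj : injective petersen_edge_code.
Proof. exact: edge_code_inj vertex_code_inj petersen_codes_codom. Qed.

Lemma petersen_edge_codes_codom :
  petersen_edge_codes =i codom petersen_edge_code.
Proof.
exact: mem_edge_codes petersen_codes_codom vertex_code_adj.
Qed.

Lemma petersen_edge_code_mem e : petersen_edge_code e \in petersen_edge_codes.
Proof. by rewrite petersen_edge_codes_codom codom_f. Qed.

Lemma has_countsP (s : signature petersen) (N : seq (seq (seq nat))) m n :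
    (forall e, s e = (petersen_edge_code e \in N)) -> has_counts N m n ->
  num_negative_cycles s 5 = m /\ num_negative_cycles s 6 = n.
Proof.
move=> sE /andP[/eqP <- /eqP <-].
by split; apply: (num_negative_cycles_code vertex_code_inj
  petersen_codes_codom vertex_code_adj).
Qed.

Lemma negative_edges_code (s : signature petersen) (es : seq (edge petersen)) :
    negative_edges s =i es ->
  forall e, s e = (petersen_edge_code e \in map petersen_edge_code es).
Proof.
move=> s_es e.
by rewrite (mem_map petersen_edge_code_inj) -s_es mem_negative_edges.
Qed.

(** * Evaluation of the counts and of the triples at pairwise distance 3 *)

Lemma counts_all_pos : has_counts [::] 0 0.
Proof. by vm_compute. Qed.

Lemma counts_P1 : all (fun c => has_counts [:: c] 4 4) petersen_edge_codes.
Proof. by vm_compute. Qed.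

Lemma counts_P22 :
  all (fun c => all (fun d => has_counts [:: c; d] 6 6)
    [seq d <- petersen_edge_codes | dist2_codes petersen_codes adj_codes c d])
  petersen_edge_codes.
Proof. by vm_compute. Qed.

Lemma counts_P23 :
  all (fun c => all (fun d => has_counts [:: c; d] 8 4)
    [seq d <- petersen_edge_codes | far_codes c d])
  petersen_edge_codes.
Proof. by vm_compute. Qed.

Lemma counts_P32 :
  all (fun t => has_counts (alternate_codes petersen_codes t) 6 10)
    (cycle_walks petersen_codes adj_codes 6).
Proof. by vm_compute. Qed.

(** Every order of a triple is listed, so no symmetry argument is needed to apply the evaluations
    below. *)
Definition far_triples : seq (seq (seq (seq nat))) :=
  flatten [seq flatten [seq [seq [:: c; d; e]
    | e <- petersen_edge_codes & far_codes c e && far_codes d e]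
    | d <- petersen_edge_codes & far_codes c d]
    | c <- petersen_edge_codes].

Lemma counts_P33 : all (fun N => has_counts N 12 0) far_triples.
Proof. by vm_compute. Qed.

(* flatten N lists the six ends of the edges in N; an edge crosses the cut
   around them when the parity is odd. *)
Lemma far_triples_cut :
  all (fun N => all (fun c => (c \in N) == ~~ odd (count (mem (flatten N)) c))
    petersen_edge_codes) far_triples.
Proof. by vm_compute. Qed.

Lemma far_triples_uniq : all uniq far_triples.
Proof. by vm_compute. Qed.

(** This supplies the third edge that links two negative edges at distance 3 to the cut around a
    triple. *)
Lemma far_pairs_third :
  all (fun c => all (fun d =>
      has (fun e => [:: c; d; e] \in far_triples) petersen_edge_codes)
    [seq d <- petersen_edge_codes | far_codes c d])
  petersen_edge_codes.
Proof. by vm_compute. Qed.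

(** * The action of the permutations of five points on the Petersen graph *)

Lemma perm_vertex_subproof (p : {perm 'I_5}) (x : petersen) :
  #|p @: val x| == 2.
Proof. by rewrite card_imset ?(valP x) //; apply: perm_inj. Qed.

Definition perm_vertex (p : {perm 'I_5}) (x : petersen) : petersen :=
  Sub (p @: val x) (perm_vertex_subproof p x).

Lemma perm_vertex_adj p (x y : petersen) :
  adj (perm_vertex p x) (perm_vertex p y) = adj x y.
Proof.
rewrite /= /petersen_adj !SubK -!setI_eq0 -imsetI ?imset_eq0 //.
by move=> i j _ _; apply: perm_inj.
Qed.

Lemma perm_vertex_inj p : injective (perm_vertex p).
Proof.
move=> x y /(congr1 val); rewrite !SubK => /(imset_inj (@perm_inj _ p)).
exact: val_inj.
Qed.

Lemma petersen_edgeP (e : edge petersen) :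
  exists x y : petersen, exists i j k l : 'I_5,
    [/\ val e = [set x; y], val x = [set i; j], val y = [set k; l]
      & uniq [:: i; j; k; l]].
Proof.
case/existsP: (valP e) => x /existsP[y /andP[adj_xy /eqP val_e]].
have /cards2P[i [j [ij val_x]]] := valP x.
have /cards2P[k [l [kl val_y]]] := valP y.
exists x, y, i, j, k, l; split=> //.
move: adj_xy; rewrite /= /petersen_adj val_x val_y -setI_eq0 => /eqP/setP xy0.
(* Evaluating the empty intersection at [i] and at [j] shows that neither is [k] or [l]. *)
have := xy0 i; have := xy0 j; rewrite !inE !eqxx orbT /=.
by case/norP=> jk jl /norP[ik il]; rewrite !negb_or ij ik il jk jl kl.
Qed.

(** An edge is given by four distinct points, split into two pairs; a permutation matching the four
    points of [e] with those of [f] carries [e] to [f]. *)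
Lemma petersen_edge_transitive (e f : edge petersen) :
  exists p : {perm 'I_5}, val f = perm_vertex p @: val e.
Proof.
have [x [y [i [j [k [l [val_e val_x val_y e_uniq]]]]]]] := petersen_edgeP e.
have [x' [y' [i' [j' [k' [l' [val_f val_x' val_y' f_uniq]]]]]]] :=
  petersen_edgeP f.
have [p [pi pj pk pl]] := perm_of_uniq_seqs e_uniq f_uniq erefl.
exists p; rewrite val_e val_f imsetU1 imset_set1.
congr [set _; _]; apply: val_inj.
  by rewrite SubK val_x val_x' imsetU1 imset_set1 pi pj.
by rewrite SubK val_y val_y' imsetU1 imset_set1 pk pl.
Qed.

(** * Switching isomorphisms *)

Lemma bigaddb_edge_code (Z : seq (seq nat)) (e : edge petersen) :
  \big[addb/false]_(v in val e) (vertex_code v \in Z) =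
    odd (count (mem Z) (petersen_edge_code e)).
Proof.
by apply: bigaddb_set_code;
  [exact: vertex_code_inj | exact: vertex_code_mem |].
Qed.

Lemma distance3_far_codes (e f : edge petersen) :
  edge_distance e f 3 ->
  far_codes (petersen_edge_code e) (petersen_edge_code f).
Proof.
exact: (edge_distance3_code vertex_code_inj petersen_codes_codom
  vertex_code_adj).
Qed.

Lemma mem_far_triples (e f g : edge petersen) :
    far_codes (petersen_edge_code e) (petersen_edge_code f) ->
    far_codes (petersen_edge_code e) (petersen_edge_code g) ->
    far_codes (petersen_edge_code f) (petersen_edge_code g) ->
  [seq petersen_edge_code x | x <- [:: e; f; g]] \in far_triples.
Proof.
move=> ef eg fg; apply/flatten_mapP.
exists (petersen_edge_code e); first exact: petersen_edge_code_mem.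
apply/flatten_mapP; exists (petersen_edge_code f).
  by rewrite mem_filter ef petersen_edge_code_mem.
by apply: map_f; rewrite mem_filter eg fg petersen_edge_code_mem.
Qed.

(** Switching the all-negative signature at the six ends of the triple makes the crossing edges
    positive. By [far_triples_cut] the edges left negative are exactly those of [N], so the identity
    map is the isomorphism. *)
Lemma far_triple_switching (s : signature petersen) N :
    N \in far_triples -> (forall e, s e = (petersen_edge_code e \in N)) ->
  switching_isomorphic s (all_neg petersen).
Proof.
move=> N_far sE; exists (fun v => vertex_code v \in flatten N), id.
split=> [|x y|e e']; [by exists id | by [] |].
rewrite imset_id => /val_inj ->.
rewrite /switch /smul /pos bigaddb_edge_code sE.
have /allP/(_ N N_far)/allP/(_ _ (petersen_edge_code_mem e)) := far_triples_cut.
by move/eqP=> ->; rewrite addbT.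
Qed.

(* If e, f, g are pairwise at distance 3, switching -P_1, with g as its positive
   edge, along the cut of far_triples_cut leaves only e and f negative; then
   edge transitivity moves g to any edge h. *)
Lemma far_pair_switching (s t : signature petersen) (e f h : edge petersen) :
    far_codes (petersen_edge_code e) (petersen_edge_code f) ->
    negative_edges s = [set e; f] -> negative_edges t = [set h] ->
  switching_isomorphic s (opp t).
Proof.
set c := petersen_edge_code e; set d := petersen_edge_code f => far_cd s_ef t_h.
have sE a : s a = (petersen_edge_code a \in [:: c; d]).
  by apply: (@negative_edges_code s [:: e; f]) => a'; rewrite s_ef !inE.
have [g N_far] : exists g, [:: c; d; petersen_edge_code g] \in far_triples.
  have c_edge := petersen_edge_code_mem e.
  have d_far : d \in [seq x <- petersen_edge_codes | far_codes c x].
    by rewrite mem_filter far_cd petersen_edge_code_mem.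
  have /allP/(_ c c_edge)/allP/(_ d d_far)/hasP[x] := far_pairs_third.
  by rewrite petersen_edge_codes_codom => /codomP[g ->]; exists g.
set N := [:: c; d; petersen_edge_code g] in N_far.
have [p val_h] := petersen_edge_transitive g h.
pose z v := vertex_code v \in flatten N.
(* The cut [z] lies in the graph that carries [s], while switching acts on the one that carries [t];
   hence the inverse permutation. *)
exists (z \o perm_vertex p^-1), (perm_vertex p).
have vertexK : cancel (perm_vertex p) (perm_vertex p^-1).
  move=> x; apply: val_inj.
  by rewrite !SubK -imset_comp (eq_imset _ (permK p)) imset_id.
split; [exact/injF_bij/perm_vertex_inj | exact: perm_vertex_adj |].
move=> a a' val_a'.
have t_a' : t a' = (a == g).
  rewrite -mem_negative_edges t_h inE -!val_eqE /= val_a' val_h.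
  exact/(inj_eq (imset_inj (@perm_vertex_inj p))).
have -> : switch (z \o perm_vertex p^-1) (opp t) a' =
    odd (count (mem (flatten N)) (petersen_edge_code a)) (+) (a != g).
  rewrite /switch /opp /smul /pos /neg t_a' addTb val_a' big_imset /=; last first.
    by move=> x y _ _; apply: perm_vertex_inj.
  rewrite -bigaddb_edge_code; congr (_ (+) _).
  by apply: eq_bigr => v _; rewrite vertexK.
have /allP/(_ N N_far)/allP/(_ _ (petersen_edge_code_mem a))/eqP :=
  far_triples_cut.
have : uniq N := allP far_triples_uniq N N_far.
rewrite /N sE /= !inE !(inj_eq petersen_edge_code_inj); move: (odd _) => b.
(* If [a] is [g], both sides are false, since [g] differs from [e] and [f]; otherwise belonging to
   [N] means being [e] or [f]. *)
rewrite negb_or; case: (eqVneq a g) => [->|_] /and3P[/andP[_ eg] fg _].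
  by rewrite orbT ![g == _]eq_sym (negbTE eg) (negbTE fg); case: b.
by rewrite orbF => ->; case: b.
Qed.

(** * The counts and isomorphisms for the six signatures *)

Theorem theorem6p1 :
  (num_negative_cycles (all_pos petersen) 5 = 0 /\
   num_negative_cycles (all_pos petersen) 6 = 0) /\
  (forall s : signature petersen, is_P1 s ->
     num_negative_cycles s 5 = 4 /\ num_negative_cycles s 6 = 4) /\
  (forall s : signature petersen, is_P22 s ->
     num_negative_cycles s 5 = 6 /\ num_negative_cycles s 6 = 6) /\
  (forall s : signature petersen, is_P23 s ->
     (forall t : signature petersen, is_P1 t -> switching_isomorphic s (opp t)) /\
     num_negative_cycles s 5 = 8 /\ num_negative_cycles s 6 = 4) /\
  (forall s : signature petersen, is_P32 s ->
     num_negative_cycles s 5 = 6 /\ num_negative_cycles s 6 = 10) /\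
  (forall s : signature petersen, is_P33 s ->
     switching_isomorphic s (all_neg petersen) /\
     num_negative_cycles s 5 = 12 /\ num_negative_cycles s 6 = 0).
Proof.
split; [|split; [|split; [|split; [|split]]]].
- exact: has_countsP counts_all_pos.
- move=> s /eqP/cards1P[e s_e].
  apply: (has_countsP (@negative_edges_code s [:: e] _)).
    by move=> a; rewrite s_e !inE.
  exact: (allP counts_P1) (petersen_edge_code_mem e).
- move=> s [e [f [s_ef dist_ef]]].
  apply: (has_countsP (@negative_edges_code s [:: e; f] _)).
    by move=> a; rewrite s_ef !inE.
  have /allP/(_ _ (petersen_edge_code_mem e))/allP := counts_P22.
  apply; rewrite mem_filter petersen_edge_code_mem andbT.
  exact: (edge_distance2_code vertex_code_inj petersen_codes_codom
    vertex_code_adj dist_ef).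
- move=> s [e [f [s_ef dist_ef]]].
  have far_ef : far_codes (petersen_edge_code e) (petersen_edge_code f).
    exact: distance3_far_codes.
  split=> [t /eqP/cards1P[h t_h]|].
    exact: far_pair_switching far_ef s_ef t_h.
  apply: (has_countsP (@negative_edges_code s [:: e; f] _)).
    by move=> a; rewrite s_ef !inE.
  have /allP/(_ _ (petersen_edge_code_mem e))/allP := counts_P23.
  by apply; rewrite mem_filter far_ef petersen_edge_code_mem.
- move=> s [v0 [v1 [v2 [v3 [v4 [v5 [v_cycle s_v]]]]]]].
  have t_walk : [seq vertex_code v | v <- [:: v0; v1; v2; v3; v4; v5]]
      \in cycle_walks petersen_codes adj_codes 6.
    rewrite mem_cycle_walks (ucycle_code vertex_code_inj vertex_code_adj).
    apply/and3P; split=> //.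
    by apply/allP=> _ /mapP[v _ ->]; apply: vertex_code_mem.
  apply: (has_countsP _ (allP counts_P32 _ t_walk)) => e.
  (* [is_P32] gives the negative edges as vertex pairs, so membership is passed through the
     injection [val]. *)
  rewrite -mem_negative_edges -(mem_imset _ _ val_inj) s_v.
  exact/esym/(mem_alternate_codes vertex_code_inj petersen_codes_codom).
- move=> s [card_s s_far].
  have [e [f [g [ef eg fg s_efg]]]] := card3_set card_s.
  have sE := negative_edges_code s_efg.
  have far x y : x \in [:: e; f; g] -> y \in [:: e; f; g] -> x != y ->
      far_codes (petersen_edge_code x) (petersen_edge_code y).
    by rewrite -!s_efg => sx sy /(s_far x y sx sy)/distance3_far_codes.
  have N_far : map petersen_edge_code [:: e; f; g] \in far_triples.
    by apply: mem_far_triples; apply: far; rewrite ?inE ?eqxx ?orbT.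
  split; first exact: far_triple_switching N_far sE.
  exact: has_countsP sE (allP counts_P33 _ N_far).
Qed.
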